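(* Let $(A,(,,),\alpha)$ be a ternary totally Hom-associative algebra whose two twisting maps are equal (to $\alpha$). Define the triple product $$\{xyz\}=(xyz)+(zyx)$$ for $x,y,z\in A$. Then $J(A)=(A,\{,,\},\alpha)$ is a Hom-Jordan triple system. Moreover, if $A$ is multiplicative, then so is $J(A)$.
   Context: We work over a fixed field $\mathbf{k}$ of characteristic $0$. A ternary Hom-algebra $(V,(,,),(\alpha_1,\alpha_2))$ consists of a $\mathbf{k}$-module $V$, a trilinear map $(,,)\colon V^{\otimes 3}\to V$, written $(xyz)$, and linear maps $\alpha_1,\alpha_2\colon V\to V$ (the twisting maps). When $\alpha_1=\alpha_2=\alpha$ we write $(V,(,,),\alpha)$. It is multiplicative if $\alpha_1=\alpha_2=\alpha$ and $\alpha\circ(,,)=(,,)\circ\alpha^{\otimes 3}$. The triple product may be denoted by other brackets. A ternary totally Hom-associative algebra is a ternary Hom-algebra with $((uvw)\alpha_1(x)\alpha_2(y))=(\alpha_1(u)(vwx)\alpha_2(y))=(\alpha_1(u)\alpha_2(v)(wxy))$ for all $u,v,w,x,y$. A Hom-Jordan triple system is a ternary Hom-algebra $(J,\{,,\},(\alpha_1,\alpha_2))$ with $\{xyz\}=\{zyx\}$ and $$\{\alpha_1(x)\alpha_2(y)\{uvw\}\}-\{\alpha_1(u)\alpha_2(v)\{xyw\}\}=\{\{xyu\}\alpha_1(v)\alpha_2(w)\}-\{\alpha_1(u)\{yxv\}\alpha_2(w)\}$$ for all $u,v,w,x,y,z\in J$. *)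

(* Defs.v *)
From mathcomp Require Import all_boot all_algebra.

Set Implicit Arguments.
Unset Strict Implicit.
Unset Printing Implicit Defensive.

Import GRing.Theory.
Local Open Scope ring_scope.

Definition trilinear (k : fieldType) (V : lmodType k)
    (mu : V -> V -> V -> V) : Prop :=
  [/\ forall y z, linear (fun x => mu x y z),
      forall x z, linear (fun y => mu x y z)
    & forall x y, linear (fun z => mu x y z)].

Definition ternary_hom_algebra (k : fieldType) (V : lmodType k)
    (mu : V -> V -> V -> V) (alpha1 alpha2 : V -> V) : Prop :=
  [/\ trilinear mu, linear alpha1 & linear alpha2].

(* A property of ternary Hom-algebras: linearity is not repeated here. *)
Definition hom_multiplicative (k : fieldType) (V : lmodType k)
    (mu : V -> V -> V -> V) (alpha1 alpha2 : V -> V) : Prop :=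
  alpha1 =1 alpha2 /\
  forall x y z, alpha1 (mu x y z) = mu (alpha1 x) (alpha1 y) (alpha1 z).

Definition totally_hom_associative (k : fieldType) (V : lmodType k)
    (mu : V -> V -> V -> V) (alpha1 alpha2 : V -> V) : Prop :=
  ternary_hom_algebra mu alpha1 alpha2 /\
  forall u v w x y,
    mu (mu u v w) (alpha1 x) (alpha2 y) = mu (alpha1 u) (mu v w x) (alpha2 y) /\
    mu (alpha1 u) (mu v w x) (alpha2 y) = mu (alpha1 u) (alpha2 v) (mu w x y).

Definition hom_jordan_triple_system (k : fieldType) (V : lmodType k)
    (mu : V -> V -> V -> V) (alpha1 alpha2 : V -> V) : Prop :=
  [/\ ternary_hom_algebra mu alpha1 alpha2,
      forall x y z, mu x y z = mu z y x
    & forall u v w x y,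
        mu (alpha1 x) (alpha2 y) (mu u v w) - mu (alpha1 u) (alpha2 v) (mu x y w)
        = mu (mu x y u) (alpha1 v) (alpha2 w)
          - mu (alpha1 u) (mu y x v) (alpha2 w)].

Definition jordan_product (k : fieldType) (V : lmodType k)
    (mu : V -> V -> V -> V) : V -> V -> V -> V :=
  fun x y z => mu x y z + mu z y x.

(* Main.v *)
(* In a totally Hom-associative algebra with equal twisting maps, every double
   product depends only on the word of its five arguments, as in an
   associative algebra.  Both sides of the Hom-Jordan identity then expand to
   [xyuvw + wvuyx - uvxyw - wyxvu]. *)

Require Import Defs.
From mathcomp Require Import all_boot all_algebra.

Import GRing.Theory.
Local Open Scope ring_scope.

Lemma linear_addfun (k : fieldType) (U V : lmodType k) (f g : U -> V) :
  linear f -> linear g -> linear (fun x => f x + g x).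
Proof. by move=> fL gL a x y; rewrite fL gL scalerDr addrACA. Qed.

Lemma linear_add (k : fieldType) (U V : lmodType k) (f : U -> V) :
  linear f -> {morph f : x y / x + y}.
Proof. by move=> fL x y; have := fL 1 x y; rewrite !scale1r. Qed.

(** The reversed summand swaps the outer slots, so linearity in either one draws on both [mu1] and
    [mu3]. *)
Lemma jordan_product_trilinear (k : fieldType) (V : lmodType k)
    (mu : V -> V -> V -> V) :
  trilinear mu -> trilinear (jordan_product mu).
Proof.
by case=> mu1 mu2 mu3; split=> x y; apply: linear_addfun.
Qed.

Lemma jordan_productC (k : fieldType) (V : lmodType k)
    (mu : V -> V -> V -> V) x y z :
  jordan_product mu x y z = jordan_product mu z y x.
Proof. exact: addrC. Qed.

Lemma jordan_product_identity (k : fieldType) (V : lmodType k)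
    (mu : V -> V -> V -> V) (alpha : V -> V) (J := jordan_product mu) :
  totally_hom_associative mu alpha alpha ->
  forall u v w x y,
    J (alpha x) (alpha y) (J u v w) - J (alpha u) (alpha v) (J x y w)
    = J (J x y u) (alpha v) (alpha w) - J (alpha u) (J y x v) (alpha w).
Proof.
case=> -[[mu1 mu2 mu3] _ _] muA u v w x y.
have muDl b c : {morph (fun a => mu a b c) : p q / p + q}.
  exact: linear_add (mu1 b c).
have muDm a c : {morph (fun b => mu a b c) : p q / p + q}.
  exact: linear_add (mu2 a c).
have muDr a b : {morph mu a b : p q / p + q}.
  exact: linear_add (mu3 a b).
(* Normal form: [mulA] and [mumA] push the inner product into the last slot, so equal words become
   syntactically equal terms. *)
have mulA a b c d e :
    mu (mu a b c) (alpha d) (alpha e) = mu (alpha a) (alpha b) (mu c d e).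
  by have [-> ->] := muA a b c d e.
have mumA a b c d e :
    mu (alpha a) (mu b c d) (alpha e) = mu (alpha a) (alpha b) (mu c d e).
  by have [_ ->] := muA a b c d e.
rewrite /J /jordan_product !(muDl, muDm, muDr) !(mulA, mumA).
(* Moving both subtracted terms across leaves eight positive words on each side. *)
apply/eqP; rewrite subr_eq [eqbRHS]addrAC eq_sym subr_eq eq_sym; apply/eqP.
(* The left side lists xyuvw, xywvu, uvwyx, wvuyx, uyxvw, uvxyw, wyxvu, wvxyu; the permutation puts
   them in the order of the right side. *)
by rewrite !addrA [LHS](ACl (1*5*8*4*6*3*2*7)).
Qed.

(** Additivity of [alpha1] splits the image of the sum, and multiplicativity of [mu] then applies to
    each summand. *)
Lemma jordan_product_multiplicative (k : fieldType) (V : lmodType k)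
    (mu : V -> V -> V -> V) (alpha1 alpha2 : V -> V) :
  linear alpha1 -> hom_multiplicative mu alpha1 alpha2 ->
  hom_multiplicative (jordan_product mu) alpha1 alpha2.
Proof.
move=> alphaL [eq_alpha alphaM]; split=> // x y z.
by rewrite /jordan_product (linear_add _ _ _ _ alphaL) !alphaM.
Qed.

Theorem theorem4p1 (k : fieldType) (char_k0 : [pchar k] =i pred0)
    (A : lmodType k) (mu : A -> A -> A -> A) (alpha : A -> A)
    (hA : totally_hom_associative mu alpha alpha) :
  hom_jordan_triple_system (jordan_product mu) alpha alpha /\
  (hom_multiplicative mu alpha alpha ->
   hom_multiplicative (jordan_product mu) alpha alpha).
Proof.
have [[muL alphaL _] _] := hA.
split; last exact: jordan_product_multiplicative.
split; first by split=> //; apply: jordan_product_trilinear.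
  exact: jordan_productC.
exact: jordan_product_identity.
Qed.
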